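(* For any polynomial $p\in\mathbb{Z}[x]$ with $p(0)=0$ and $\deg(p)>1$, there exist an invertible probability preserving system $(X,\mathcal{A},\mu,T)$, a set $A\in\mathcal{A}$ with $\mu(A)=\frac12$, a real number $\delta>0$, and an IP$_0$ set $\Gamma\subseteq\mathbb{N}$ such that for any $n\in\Gamma$, $$\mu(A\cap T^{-p(n)}A)<\mu^2(A)-\delta .$$
   Context: $\mathbb{N}=\{1,2,\dots\}$, and $\mu^2(A)=(\mu(A))^2$. An invertible probability preserving system $(X,\mathcal{A},\mu,T)$ is a probability space $(X,\mathcal{A},\mu)$ together with an invertible (bimeasurable) $\mu$-preserving map $T:X\to X$. For $r\in\mathbb{N}$, a set $E\subseteq\mathbb{N}$ is called IP$_r$ if there exist positive integers $n_1<\cdots<n_r$ with $\{\sum_{j\in F}n_j \mid F\subseteq\{1,\dots,r\},\ F\neq\emptyset\}\subseteq E$. A set $\Gamma\subseteq\mathbb{N}$ is called IP$_0$ if it is an IP$_r$ set for every $r\in\mathbb{N}$. *)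

(* Defs.v *)
(* MathComp / MathComp-Analysis *)
From HB Require Import structures.
From mathcomp Require Import all_boot all_order all_algebra.
From mathcomp Require Import all_classical all_reals all_analysis.

Set Implicit Arguments.
Unset Strict Implicit.
Unset Printing Implicit Defensive.

Import Order.TTheory GRing.Theory Num.Theory.
Local Open Scope classical_set_scope.
Local Open Scope ring_scope.

(* The inverse map is carried as data; invariance of [pps_mu] under it follows
   from [pps_invariant]. *)
Record invertible_pps (R : realType) := InvertiblePPS {
  pps_display : measure_display;
  pps_space : measurableType pps_display;
  pps_mu : probability pps_space R;
  pps_map : pps_space -> pps_space;
  pps_inv : pps_space -> pps_space;
  pps_mapK : cancel pps_map pps_inv;
  pps_invK : cancel pps_inv pps_map;
  pps_map_measurable : measurable_fun [set: pps_space] pps_map;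
  pps_inv_measurable : measurable_fun [set: pps_space] pps_inv;
  pps_invariant : forall A : set pps_space,
    measurable A -> pps_mu (pps_map @^-1` A) = pps_mu A
}.

(* [Negz m] is the integer - (m + 1). *)
Definition pps_iter (R : realType) (S : invertible_pps R) (k : int)
    : pps_space S -> pps_space S :=
  match k with
  | Posz m => iter m (@pps_map R S)
  | Negz m => iter m.+1 (@pps_inv R S)
  end.

Arguments pps_iter {R} S k _.

Definition is_IP_r (r : nat) (E : set nat) : Prop :=
  exists n : 'I_r -> nat,
    [/\ forall i, (0 < n i)%N,
        forall i j : 'I_r, (i < j)%N -> (n i < n j)%N
      & forall F : {set 'I_r}, F != finset.set0 -> E (\sum_(j in F) n j)%N].

Definition is_IP_0 (E : set nat) : Prop :=
  forall r : nat, (0 < r)%N -> is_IP_r r E.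

(* Main.v *)
(** For a random real x(w) and a uniform y, let T be the skew rotation (w, y) |-> (w, y + x(w))
    and A = { y mod 1 < 1/2 }.  Then the measure of A /\ T^-m A is the mean of |1/2 - {m x}|, so it
    is enough that m x be close to 1/2 modulo 1 with probability 3/4 for every m = p(n) with n in
    Gamma.

    Let d = deg p, let a be its leading coefficient, let U, V be independent uniform subsets of
    {1, ..., r}, and put L1 = #|U :&: F|, L2 = #|V :&: F|.  For d > 1 the form
    L1^d + L2^d + L1^(d-1) L2 is odd unless L1 and L2 are both even, hence with probability 3/4
    when F is nonempty.  It is homogeneous of degree d in the indicator functions of the elements
    of F, so it can be read off the base B expansion of p(n_F) when n_i = B^((d+1)^i): a monomial of
    degree at most d in the n_i is a power of B whose exponent determines the monomial, and
    multiplying p(n_F) by sum_w s_w B^-w yields, modulo 1 and up to O(1/B), the digits of p(n_F)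
    weighted by the s_w.

    Finally x is a sum over the ranks r of such random numbers x_r.  The base of rank r is a
    multiple of the denominators of all earlier x_s, which therefore vanish modulo 1 after
    multiplication by p(n_F), and the later x_s are too small to matter. *)
Require Import Defs.
From HB Require Import structures.
From mathcomp Require Import all_boot all_order all_algebra.
From mathcomp Require Import zify ring lra.
From mathcomp Require Import all_classical all_reals all_analysis.
From mathcomp Require Import measurable_realfun.

Import Order.TTheory GRing.Theory Num.Theory.
Import numFieldNormedType.Exports.
Local Open Scope classical_set_scope.
Local Open Scope ring_scope.

(** * Base expansions *)

Lemma base_expansion_inj (b r : nat) (x y : nat -> nat) :
  (forall i, x i < b)%N -> (forall i, y i < b)%N ->
  (\sum_(i < r) x i * b ^ i = \sum_(i < r) y i * b ^ i)%N ->
  forall i, (i < r)%N -> x i = y i.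
Proof.
elim: r x y => [|r IH] x y xb yb //; rewrite !big_ord_recl /= !expn0 !muln1.
have shift z : (\sum_(i < r) z (bump 0 i) * b ^ bump 0 i =
    b * \sum_(i < r) z i.+1 * b ^ i)%N.
  by rewrite big_distrr /=; apply: eq_bigr => i _; rewrite /bump /= add1n expnS mulnCA.
have b0 : (0 < b)%N by rewrite (leq_ltn_trans _ (xb 0%N)).
rewrite !shift => xy.
have /= e0 := congr1 (modn^~ b) xy.
have e1 : x 0%N = y 0%N.
  by move: e0; rewrite !(addnC (_ 0%N)) ![(b * _)%N]mulnC !modnMDl !modn_small.
move: xy; rewrite e1 => /addnI /eqP; rewrite eqn_pmul2l// => /eqP xyS.
case=> // i; rewrite ltnS.
exact: (IH (x \o S) (y \o S) (fun j => xb j.+1) (fun j => yb j.+1) xyS).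
Qed.

Section weights.
Variables (d r : nat).

(** The product over l of the powers B^(d.+1 ^ f l) is B to the power [weight k f]. *)
Definition weight k (f : {ffun 'I_k -> 'I_r}) : nat := \sum_l d.+1 ^ f l.

Lemma weight_fiber k (f : {ffun 'I_k -> 'I_r}) :
  weight k f = (\sum_(i < r) #|[pred l | f l == i]| * d.+1 ^ i)%N.
Proof.
rewrite /weight (partition_big f predT)//=; apply: eq_bigr => i _.
by rewrite (eq_bigr (fun=> d.+1 ^ i)%N) ?sum_nat_const// => l /eqP ->.
Qed.

(** As d + 1 is 1 modulo d, each of the k summands contributes 1. *)
Lemma weight_mod k (f : {ffun 'I_k -> 'I_r}) : weight k f = k %[mod d].
Proof.
rewrite /weight -[X in _ = X %[mod _]]card_ord -sum1_card.
apply: (big_ind2 (fun x y => x = y %[mod d])) => // [x1 x2 y1 y2 h1 h2|i _].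
  by rewrite -modnDm h1 h2 modnDm.
by rewrite -modnXm -addn1 modnDl modnXm exp1n.
Qed.

Lemma weight_gt0 k (f : {ffun 'I_k -> 'I_r}) : (0 < k)%N -> (0 < weight k f)%N.
Proof.
case: k f => // k f _.
by rewrite /weight big_ord_recl addn_gt0 expn_gt0.
Qed.

Lemma weight_bound k (f : {ffun 'I_k -> 'I_r}) : (weight k f <= k * d.+1 ^ r)%N.
Proof.
rewrite /weight -[k in leqRHS]card_ord -sum_nat_const.
by apply: leq_sum => i _; rewrite leq_pexp2l// ltnW.
Qed.

(** The base d + 1 digits of the weight are the fibre sizes of f, which are at most d. The weight
    thus determines f up to a permutation of the indices l, which leaves the product unchanged. *)
Lemma weight_inj_prod (S : comNzRingType) (P : 'I_r -> S) (f g : {ffun 'I_d -> 'I_r}) :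
  weight d f = weight d g -> \prod_l P (f l) = \prod_l P (g l).
Proof.
move=> fg.
have fiber_eq i : #|[pred l | f l == i]| = #|[pred l | g l == i]|.
  pose c (h : {ffun 'I_d -> 'I_r}) (j : nat) := #|[pred l | (h l : nat) == j]|.
  have cE (h : {ffun 'I_d -> 'I_r}) (j : 'I_r) : #|[pred l | h l == j]| = c h j by [].
  have cb h j : (c h j < d.+1)%N by rewrite ltnS -[leqRHS](card_ord d) max_card.
  rewrite !cE; apply: (@base_expansion_inj d.+1 r) => //.
  by move: fg; rewrite !weight_fiber.
have prodE (h : {ffun 'I_d -> 'I_r}) :
    \prod_l P (h l) = \prod_i P i ^+ #|[pred l | h l == i]|.
  rewrite (partition_big h predT)//=; apply: eq_bigr => i _.
  by rewrite (eq_bigr (fun=> P i)) ?prodr_const// => l /eqP ->.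
by rewrite !prodE; apply: eq_bigr => i _; rewrite fiber_eq.
Qed.

End weights.

(** * Approximation modulo 1 *)

Section approx.
Variable R : realType.
Implicit Types (x y e : R).

Definition approx_mod1 x y e := exists z : int, `|x - y - z%:~R| <= e.

Lemma approx_mod1_sum (I : finType) (P : pred I) (x y e : I -> R) :
  (forall i, P i -> approx_mod1 (x i) (y i) (e i)) ->
  approx_mod1 (\sum_(i | P i) x i) (\sum_(i | P i) y i) (\sum_(i | P i) e i).
Proof.
move=> h; apply: (big_rec3 (fun a b c => approx_mod1 b c a)).
  by exists 0; rewrite !subr0 normr0.
move=> i a b c Pi [z1 hz1]; have [z2 hz2] := h i Pi; exists (z2 + z1).
rewrite (_ : _ - _ = (x i - y i - z2%:~R) + (b - c - z1%:~R)); last by rewrite intrD; ring.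
by rewrite (le_trans (ler_normD _ _))// lerD.
Qed.

Lemma approx_mod1Z (c : int) x y e : approx_mod1 x y e ->
  approx_mod1 (c%:~R * x) (c%:~R * y) (`|c|%:~R * e).
Proof.
move=> [z hz]; exists (c * z).
by rewrite intrM -!mulrBr normrM -intr_norm ler_wpM2l.
Qed.

Lemma approx_mod1W x y e e' : e <= e' -> approx_mod1 x y e -> approx_mod1 x y e'.
Proof. by move=> ee' [z hz]; exists z; apply: le_trans ee'. Qed.

(** For m > w a factor B is left over, and B * s is an integer; for m < w a factor 1/B is left over,
    and the product itself is small. *)
Lemma approx_mod1_digit (B m w : nat) (s : R) : (0 < B)%N -> B%:R * s \is a Num.int ->
  approx_mod1 (B%:R ^+ m * (s * B%:R ^- w)) (if m == w then s else 0) (`|s| / B%:R).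
Proof.
move=> B0 /intrP[z hz].
have B0' : B%:R != 0 :> R by rewrite pnatr_eq0 -lt0n.
have sB0 : 0 <= `|s| / B%:R by rewrite divr_ge0.
have Bw : B%:R ^+ w * B%:R ^- w = 1 :> R by rewrite mulfV ?expf_neq0.
have [mw|mw|->] := ltngtP m w; last 2 first.
- exists (z * B%:Z ^+ (m - w).-1).
  rewrite intrM -hz rmorphXn /= subr0 [X in X ^+ _.-1](_ : _ = B%:R)//.
  have -> : m = ((m - w).-1.+1 + w)%N by lia.
  rewrite addnK /= exprD exprS.
  set Bk := B%:R ^+ _; set u := B%:R ^+ w in Bw *.
  rewrite (_ : _ - _ = (u / u - 1) * (B%:R * s * Bk)); last by ring.
  by rewrite Bw subrr mul0r normr0.
- by exists 0; rewrite mulrCA Bw mulr1 !subrr normr0.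
exists 0; rewrite !subr0 mulrCA normrM ler_wpM2l// ger0_norm; last first.
  by rewrite mulr_ge0 ?invr_ge0 ?exprn_ge0.
have -> : w = ((w - m).-1.+1 + m)%N by lia.
rewrite exprD invfM mulrCA mulfV ?expf_neq0// mulr1 lef_pV2 ?posrE ?exprn_gt0 ?ltr0n//.
by rewrite ler_eXnr// ler1n.
Qed.

End approx.

(** * Digits that encode the parity form *)

Lemma expr_sum_ffun (S : comPzSemiRingType) (I : finType) (F : pred I) (z : I -> S) k :
  (\sum_(i | F i) z i) ^+ k =
  \sum_(f : {ffun 'I_k -> I} | f \in ffun_on F) \prod_l z (f l).
Proof. by rewrite -[k in LHS]card_ord -prodr_const bigA_distr_big. Qed.

Lemma coef_exprDX (S : comNzRingType) (a b : S) (n k : nat) :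
  ((a%:P + b%:P * 'X) ^+ n)`_k = a ^+ (n - k) * b ^+ k *+ 'C(n, k).
Proof.
rewrite exprDn coef_sum.
under eq_bigr => i _ do
  rewrite exprMn mulrA -!polyC_exp -polyCM coefMn coefCM coefXn eq_sym.
have [kn|nk] := ltnP k n.+1; last first.
  rewrite bin_small// mulr0n big1// => i _.
  by rewrite ltn_eqF ?mulr0 ?mul0rn// (leq_trans (ltn_ord i) nk).
rewrite (bigD1 (Ordinal kn))//= eqxx mulr1 big1 ?addr0// => i ik.
by rewrite (_ : (_ == _) = false) ?mulr0 ?mul0rn//; apply/negbTE.
Qed.

Section digits.
Variables (R : realType) (d r : nat).
Hypothesis d_gt1 : (1 < d)%N.
Implicit Types (U V F : {set 'I_r}).

(* Takes (L1 + L2 X)^d to half of L1^d + L2^d + L1^(d-1) L2: the division by d cancels the binomial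
   coefficient. *)
Definition functional (Q : {poly int}) : R :=
  ((Q`_0 + Q`_d)%:~R + (Q`_1)%:~R / d%:R) / 2.

Lemma functional_sum (I : finType) (P : pred I) (Q : I -> {poly int}) :
  functional (\sum_(i | P i) Q i) = \sum_(i | P i) functional (Q i).
Proof.
apply: (big_morph functional) => [x y|].
  by rewrite /functional !coefD !intrD; field; rewrite pnatr_eq0 -lt0n; lia.
by rewrite /functional !coef0 addr0 mul0r addr0 mul0r.
Qed.

(** One polynomial carries both indicators: its sum over F is L1 + L2 X, and the form in L1 and L2
    becomes a linear functional of the d-th power, to be applied to each product in the expansion
    separately. *)
Definition linear_pair U V (i : 'I_r) : {poly int} :=
  ((i \in U)%:R)%:P + ((i \in V)%:R)%:P * 'X.

Lemma sum_linear_pair U V F : \sum_(i in F) linear_pair U V i =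
  (#|U :&: F|%:R)%:P + (#|V :&: F|%:R)%:P * 'X.
Proof.
have card (W : {set 'I_r}) : \sum_(i in F) (i \in W)%:R = #|W :&: F|%:R :> int.
  rewrite -sum1_card natr_sum [RHS](eq_bigl (fun i => (i \in F) && (i \in W))).
    by rewrite big_mkcondr; apply: eq_bigr => i _; case: (i \in W).
  by move=> i; rewrite inE andbC.
by rewrite /linear_pair big_split /= -mulr_suml -!(rmorph_sum polyC) /= !card.
Qed.

Definition value U V (f : {ffun 'I_d -> 'I_r}) : R :=
  functional (\prod_l linear_pair U V (f l)).

Lemma sum_value U V F : \sum_(f : {ffun 'I_d -> 'I_r} | f \in ffun_on (mem F)) value U V f =
  (#|U :&: F| ^ d + #|V :&: F| ^ d + #|U :&: F| ^ d.-1 * #|V :&: F|)%N%:R / 2.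
Proof.
rewrite -functional_sum -expr_sum_ffun sum_linear_pair /functional !coef_exprDX.
rewrite subn0 subnn !expr0 bin0 binn bin1 subn1 !mulr1n expr1 mulr1 mul1r.
rewrite -[X in X%:~R / d%:R]mulr_natr -!natrX -!natrM -!natrD !(rmorph_nat intr) natrM.
rewrite mulfK ?natrD//.
by rewrite pnatr_eq0 -lt0n; lia.
Qed.

Variable a : int.
Hypothesis a_neq0 : a != 0.

(* The choice of [f] is immaterial by [weight_inj_prod]. *)
Definition digit U V (w : nat) : R :=
  if [pick f | weight d r d f == w] is Some f then value U V f / a%:~R else 0.

Lemma digit_weight U V f : digit U V (weight d r d f) = value U V f / a%:~R.
Proof.
rewrite /digit; case: pickP => [g /eqP gf|/(_ f)]; last by rewrite eqxx.
by rewrite /value; congr (functional _ / _); apply: weight_inj_prod.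
Qed.

(* Weights are congruent to the degree modulo d, so that the terms of p of degree between 0 and d
   do not meet the support of [digit]. *)
Lemma digit_weight_lt U V k (f : {ffun 'I_k -> 'I_r}) : (k < d)%N ->
  digit U V (weight d r k f) = if k == 0%N then digit U V 0 else 0.
Proof.
move=> kd; case: eqP => [k0|/eqP k0].
  by subst k; rewrite /weight big_ord0.
rewrite /digit; case: pickP => // g /eqP /(congr1 (modn^~ d)).
rewrite !weight_mod modnn modn_small// => k0'.
by rewrite -k0' eqxx in k0.
Qed.

Lemma digit0 U V : digit U V 0 = 0.
Proof.
rewrite /digit; case: pickP => // g; have := @weight_gt0 d r d g (ltnW d_gt1).
by case: weight.
Qed.

(** The 2 comes from the half in [functional], d from the division of the linear coefficient, |a|
    from the division in [digit]. *)
Lemma digit_denominator U V w : (2 * d * `|a|)%N%:R * digit U V w \is a Num.int.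
Proof.
rewrite /digit; case: pickP => [f _|_]; last by rewrite mulr0.
rewrite /value /functional; set Q := \prod_l _.
have d0 : d%:R != 0 :> R by rewrite pnatr_eq0 -lt0n; lia.
have a0 : a%:~R != 0 :> R by rewrite intr_eq0.
have -> : (2 * d * `|a|)%N%:R = 2 * d%:R * ((-1) ^+ (a < 0)%R * a%:~R) :> R.
  rewrite !natrM; congr (_ * _).
  rewrite pmulrn abszE -[X in _ = X * _](rmorph_sign (intr : int -> R)) -intrM.
  by rewrite -normrEsign.
set sg := (-1) ^+ _; have sgZ : sg \is a Num.int by rewrite rpredX// rpredN rpred1.
move: sg sgZ => sg sgZ.
rewrite [X in X \is a _](_ : _ = sg * (d%:R * (Q`_0 + Q`_d)%:~R + (Q`_1)%:~R)).
  by rewrite rpredM// rpredD ?rpredM ?intr_int ?natr_int.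
by field; rewrite d0 a0.
Qed.

End digits.

(** * Values of the polynomial at subset sums *)

Section polynomial_values.
Variables (R : realType) (p : {poly int}) (r : nat).
Hypotheses (p0 : p.[0] = 0) (degp : (1 < (size p).-1)%N).
Implicit Types (U V F : {set 'I_r}) (B : nat).

Notation d := (size p).-1.
Notation a := (lead_coef p).

Let a_neq0 : a != 0.
Proof. by rewrite lead_coef_eq0; apply: contraTneq degp => ->; rewrite size_poly0. Qed.

Definition generator B (i : 'I_r) : nat := B ^ (d.+1 ^ i).

Notation W := (d * d.+1 ^ r).+1.

Definition frequency B U V : R := \sum_(w < W) digit R d r a U V w * B%:R ^- w.

Definition digit_norm U V : R := \sum_(w < W) `|digit R d r a U V w|.

(** Here r^k bounds the number of terms in the expansion of the k-th power of a subset sum. *)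
Definition coef_norm : R := \sum_(k < size p) `|p`_k|%:~R * (r ^ k)%N%:R.

Lemma generator_sum_exp B F k :
  ((\sum_(i in F) generator B i)%N%:R : R) ^+ k =
  \sum_(f : {ffun 'I_k -> 'I_r} | f \in ffun_on (mem F)) B%:R ^+ weight d r k f.
Proof.
rewrite natr_sum expr_sum_ffun; apply: eq_bigr => f _.
rewrite /weight (big_morph _ (exprD _) (expr0 _)); apply: eq_bigr => l _.
by rewrite /generator natrX.
Qed.

(** Only k = d contributes: weights of lower positive degree miss the support of [digit], and for k
    = 0 the digit at 0 vanishes. At k = d the leading coefficient cancels the division by a. *)
Lemma sum_digit U V F :
  \sum_(k < size p) (p`_k)%:~R *
    \sum_(f : {ffun 'I_k -> 'I_r} | f \in ffun_on (mem F))
       \sum_(w < W) (if weight d r k f == w then digit R d r a U V w else 0) =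
  \sum_(f : {ffun 'I_d -> 'I_r} | f \in ffun_on (mem F)) value R d r U V f.
Proof.
have sp : size p = d.+1 by rewrite prednK//; lia.
have weightW k (f : {ffun 'I_k -> 'I_r}) : (k < size p)%N -> (weight d r k f < W)%N.
  rewrite sp ltnS => kd; rewrite ltnS (leq_trans (weight_bound _ _ _ _))//.
  by rewrite leq_mul2r kd orbT.
have inner k (f : {ffun 'I_k -> 'I_r}) : (k < size p)%N ->
    \sum_(w < W) (if weight d r k f == w then digit R d r a U V w else 0) =
    digit R d r a U V (weight d r k f).
  move=> kp; rewrite -big_mkcond (big_pred1 (Ordinal (weightW _ f kp)))//.
have dp : (d < size p)%N by rewrite sp.
rewrite (bigD1 (Ordinal dp))//= [X in _ + X]big1 ?addr0.
  rewrite mulr_sumr; apply: eq_bigr => f _.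
  by rewrite inner// digit_weight// mulrC -lead_coefE divfK// intr_eq0.
move=> k kd; rewrite big1 ?mulr0// => f _; rewrite inner// digit_weight_lt//.
  by rewrite digit0//; case: ifP.
by rewrite ltn_neqAle kd -ltnS -sp/=.
Qed.

(** Expanding p at the subset sum into powers of B leaves a combination of terms B^m s_w B^-w.
    Modulo 1 and up to O(1/B) only those with m = w survive, and [sum_digit] adds them up. *)
Lemma frequency_approx B U V F : (0 < B)%N -> (2 * d * `|a| %| B)%N ->
  approx_mod1 R ((p.[(\sum_(i in F) generator B i)%N%:Z])%:~R * frequency B U V)
    ((#|U :&: F| ^ d + #|V :&: F| ^ d + #|U :&: F| ^ d.-1 * #|V :&: F|)%N%:R / 2)
    (coef_norm * digit_norm U V / B%:R).
Proof.
move=> B0 aB; rewrite -sum_value// -sum_digit horner_coef rmorph_sum mulr_suml /=.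
set S := (\sum_(i in F) generator B i)%N.
have -> : \sum_(k < size p) (p`_k * S%:Z ^+ k)%:~R * frequency B U V =
    \sum_(k < size p) (p`_k)%:~R *
      \sum_(f : {ffun 'I_k -> 'I_r} | f \in ffun_on (mem F))
       \sum_(w < W) B%:R ^+ weight d r k f * (digit R d r a U V w * B%:R ^- w).
  apply: eq_bigr => k _; rewrite intrM rmorphXn -mulrA; congr (_ * _).
  rewrite generator_sum_exp mulr_suml; apply: eq_bigr => f _.
  by rewrite mulr_sumr.
have Bdigit w : B%:R * digit R d r a U V w \is a Num.int.
  have /dvdnP[q ->] := aB; rewrite natrM -mulrA rpredM ?natr_int//.
  exact: digit_denominator.
apply: approx_mod1W; last first.
  apply: approx_mod1_sum => k _; apply: approx_mod1Z.
  apply: approx_mod1_sum => f _; apply: approx_mod1_sum => w _.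
  by apply: approx_mod1_digit => //; apply: Bdigit.
rewrite /coef_norm -mulrA mulr_suml; apply: ler_sum => k _.
rewrite -mulrA ler_wpM2l ?ler0z// -mulr_suml.
rewrite sumr_const -[leLHS]mulr_natl ler_wpM2r//.
  by rewrite mulr_ge0 ?invr_ge0// sumr_ge0.
rewrite ler_nat (leq_trans (max_card _))// card_ffun !card_ord//.
Qed.

Lemma frequency_small B U V : (0 < B)%N -> `|frequency B U V| <= digit_norm U V / B%:R.
Proof.
move=> B0; rewrite (le_trans (ler_norm_sum _ _ _))// /digit_norm mulr_suml.
apply: ler_sum => w _; rewrite normrM.
have [->|w0] := eqVneq (w : nat) 0%N; first by rewrite digit0// normr0 !mul0r.
rewrite ler_wpM2l// ger0_norm ?invr_ge0 ?exprn_ge0//.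
rewrite lef_pV2 ?posrE ?exprn_gt0 ?ltr0n//.
by rewrite ler_eXnr ?lt0n// ler1n.
Qed.

Lemma frequency_denominator B U V : (0 < B)%N ->
  (2 * d * `|a| * B ^ W)%N%:R * frequency B U V \is a Num.int.
Proof.
move=> B0; rewrite mulr_sumr rpred_sum// => w _; rewrite natrM.
have B0' : B%:R != 0 :> R by rewrite pnatr_eq0 -lt0n.
rewrite mulrACA rpredM//; first exact: digit_denominator.
rewrite natrX -[W in _ ^+ W](subnK (ltnW (ltn_ord w))) exprD mulfK ?expf_neq0//.
by rewrite rpredX ?natr_int.
Qed.

End polynomial_values.

(** * Frequencies of a single rank *)

Lemma approx_mod1_half (R : realType) (x e : R) (m : nat) : odd m ->
  approx_mod1 R x (m%:R / 2) e -> approx_mod1 R x (1 / 2) e.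
Proof.
move=> om [z hz]; exists (z + (m./2)%:Z).
rewrite intrD -pmulrn.
have -> : 1 / 2 = m%:R / 2 - m./2%:R :> R.
  have /(congr1 (fun k => k%:R : R)) := odd_double_half m.
  by rewrite om natrD -mul2n natrM /= => <-; field.
by rewrite (_ : _ - _ = x - m%:R / 2 - z%:~R)//; ring.
Qed.

(** The extra data link the ranks: generators divisible by D kill earlier frequencies modulo 1, M is
    the denominator passed on to later ranks, and the bound on Y makes it negligible at earlier
    ranks. *)
Lemma ip_frequencies (R : realType) (p : {poly int}) (p0 : p.[0] = 0)
    (degp : (1 < (size p).-1)%N) (r D : nat) (e : R) : (0 < D)%N -> 0 < e ->
  exists (n : 'I_r -> nat) (M : nat) (Y : {set 'I_r} * {set 'I_r} -> R),
  [/\ (forall i, 0 < n i /\ D %| n i)%N,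
      (forall i j : 'I_r, i < j -> n i < n j)%N,
      (0 < M)%N,
      forall c, `|Y c| <= e /\ M%:R * Y c \is a Num.int &
      forall (F : {set 'I_r}) c, odd #|c.1 :&: F| || odd #|c.2 :&: F| ->
        approx_mod1 R ((p.[(\sum_(i in F) n i)%N%:Z])%:~R * Y c) (1 / 2) e].
Proof.
move=> D0 e0; set d := (size p).-1; set Q := (2 * d * `|lead_coef p|)%N.
have d0 : (0 < d)%N by rewrite ltnW.
have Q0 : (0 < Q)%N.
  rewrite !muln_gt0 d0 /= absz_gt0 lead_coef_eq0.
  by apply: contraTneq degp => ->; rewrite size_poly0.
pose N c := digit_norm R p r c.1 c.2.
have N0 c : 0 <= N c by apply: sumr_ge0.
pose C := \sum_c N c.
have NC c : N c <= C by rewrite /C (bigD1 c)//= lerDl sumr_ge0.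
have cn0 : 0 <= coef_norm R p r.
  by apply: sumr_ge0 => k _; rewrite mulr_ge0 ?ler0z.
(* In [K], the 1 pays for the size of Y and [coef_norm] for the approximation error; [C] makes both
   uniform in c. In [B], the factor D reaches the generators, Q clears the denominators of the
   digits, and 2 gives B > 1, so that the generators increase. *)
pose K := (1 + coef_norm R p r) * C / e.
pose B := (2 * D * Q * (Num.truncn K).+1)%N.
have B1 : (1 < B)%N by rewrite /B; lia.
have B0 : (0 < B)%N by exact: ltnW.
have KB : K <= B%:R.
  have := truncnS_gt K => /ltW /le_trans -> //.
  by rewrite ler_nat leq_pmull// muln_gt0 Q0 muln_gt0 D0.
have bound c : (1 + coef_norm R p r) * N c / B%:R <= e.
  rewrite ler_pdivrMr ?ltr0n// (le_trans _ (ler_wpM2l (ltW e0) KB))//.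
  rewrite /K [leRHS]mulrC divfK ?gt_eqF// ler_wpM2l// addr_ge0//.
exists (generator p r B), (Q * B ^ (d * d.+1 ^ r).+1)%N, (fun c => frequency R p r B c.1 c.2).
split.
- move=> i; rewrite /generator expn_gt0 B0; split=> //.
  rewrite (@dvdn_trans B)//; last by rewrite dvdn_exp// expn_gt0.
  by rewrite /B -!mulnA dvdn_mull// dvdn_mulr.
- by move=> i j ij; rewrite /generator ltn_exp2l// ltn_exp2l// ltnS.
- by rewrite muln_gt0 Q0 expn_gt0 B0.
- move=> c; split; last exact: frequency_denominator.
  rewrite (le_trans (frequency_small _ _ _ _ _ _ _ _))// (le_trans _ (bound c))//.
  rewrite ler_wpM2r ?invr_ge0// ler_peMl//; first exact: N0.
  by rewrite lerDl.
- move=> F c codd.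
  apply: (@approx_mod1_half _ _ _
    (#|c.1 :&: F| ^ d + #|c.2 :&: F| ^ d + #|c.1 :&: F| ^ d.-1 * #|c.2 :&: F|)).
    (* Both d and d - 1 are positive, so powers keep parity and the form has the parity of L1 + L2 +
       L1 L2. *)
    have d1 : (d.-1 == 0%N) = false by rewrite /d; lia.
    rewrite !oddD oddM !oddX d1 (gtn_eqF d0) /=.
    by move: codd; do 2 case: odd.
  apply: approx_mod1W (bound c) _.
  apply: approx_mod1W (frequency_approx _ _ _ _ _ _ _ _ _ _ _) => //.
    by rewrite ler_wpM2r ?invr_ge0// ler_wpM2r ?lerDr//; apply: N0.
  by rewrite /B dvdn_mulr// dvdn_mull.
Qed.

(** Toggling the membership of a fixed element of F is an involution that exchanges even and odd
    intersections. *)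
Lemma card_even_setI (r : nat) (F : {set 'I_r}) (F0 : F != finset.set0) :
  (#|[set U : {set 'I_r} | ~~ odd #|U :&: F|]%SET| * 2 = 2 ^ r)%N.
Proof.
have /set0Pn[i iF] := F0.
pose toggle (U : {set 'I_r}) := (if i \in U then U :\ i else i |: U)%SET.
have toggleK : involutive toggle.
  move=> U; rewrite /toggle; case: (boolP (i \in U)) => iU.
    by rewrite finset.setD11 finset.setD1K.
  by rewrite finset.setU11 finset.setU1K.
have odd_toggle U : odd #|toggle U :&: F| = ~~ odd #|U :&: F|.
  have flip (V : {set 'I_r}) : i \notin V -> #|(i |: V) :&: F|%SET = #|V :&: F|.+1.
    move=> iV; rewrite finset.setIUl (finset.setIidPl _) ?finset.sub1set//.
    by rewrite cardsU1 inE (negPf iV).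
  rewrite /toggle; case: ifP => iU; last by rewrite flip// iU.
  by rewrite -[in RHS](finset.setD1K iU) flip ?negbK// finset.setD11.
set E := finset _.
have EC : (~: E = toggle @: E)%SET.
  apply/finset.setP => U; rewrite !inE negbK; apply/idP/imsetP.
    by move=> oU; exists (toggle U); rewrite ?toggleK// inE odd_toggle oU.
  by move=> [V]; rewrite inE => oV ->; rewrite odd_toggle.
rewrite muln2 -addnn -[X in (_ + X)%N](card_imset _ (inv_inj toggleK)) -EC.
by rewrite cardsC -cardsT -powersetT card_powerset cardsT card_ord.
Qed.

(** * The skew rotation *)

Lemma lebesgue_measure_shift (R : realType) (t : R) (A : set R) : measurable A ->
  lebesgue_measure ((fun y => y + t) @^-1` A) = lebesgue_measure A.
Proof.
move=> mA; pose f : measurableTypeR R -> measurableTypeR R := fun y => y + t.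
have mf : measurable_fun setT f by apply: (@measurable_funD _ R R setT id (cst t)).
rewrite -[LHS]/(measure_function_pushforward__canonical__measure_function_Measure
  lebesgue_measure mf A).
apply/esym/lebesgue_measure_unique => //= _ [[a b] _ <-].
rewrite /pushforward (_ : _ @^-1` _ = `]a - t, b - t]%classic); last first.
  by apply/seteqP; split => y /=; rewrite !in_itv/= ltrBlDr lerBrDr.
rewrite !lebesgue_measure_itv/= !lte_fin ltrD2r -!EFinB.
by case: ifP => // _; congr EFin; ring.
Qed.

Section unit_measure.
Variable R : realType.

Definition unit_measure : set (measurableTypeR R) -> \bar R :=
  mrestr lebesgue_measure (measurable_itv `[(0 : R), 1[).

HB.instance Definition _ := Measure.on unit_measure.

Let unit_measureT : unit_measure setT = 1%E.
Proof. by rewrite /unit_measure /mrestr setTI lebesgue_measure_itv/= lte_fin ltr01 sube0. Qed.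

HB.instance Definition _ := Measure_isProbability.Build _ _ R unit_measure unit_measureT.

Definition square_measure : set (measurableTypeR R * measurableTypeR R) -> \bar R :=
  (unit_measure \x unit_measure)%E.

HB.instance Definition _ := Measure.on square_measure.

Let square_measureT : square_measure setT = 1%E.
Proof.
by rewrite /square_measure -setXTT product_measure1E//= !probability_setT mule1.
Qed.

HB.instance Definition _ := Measure_isProbability.Build _ _ R square_measure square_measureT.

Definition fpart (y : R) : R := y - (Num.floor y)%:~R.

Lemma fpart_itv y : 0 <= fpart y < 1.
Proof.
rewrite /fpart subr_ge0 floor_le /= ltrBlDl.
by have := floorD1_gt y; rewrite intrD.
Qed.

Lemma fpartDz y (k : int) : fpart (y + k%:~R) = fpart y.
Proof. by rewrite /fpart floorDrz ?intr_int// intrKfloor intrD; ring. Qed.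

Lemma fpart_id y : 0 <= y < 1 -> fpart y = y.
Proof. by move=> h; rewrite /fpart (floor_def (m := 0)) ?add0r// subr0. Qed.

(* The map of a system is a bijection of the whole space, so the rotation of [0, 1[ is copied on
   every interval [k, k + 1[. *)
Definition rotate (t y : R) : R := (Num.floor y)%:~R + fpart (y + t).

Lemma floor_rotate t y : Num.floor (rotate t y) = Num.floor y.
Proof.
apply: floor_def; have /andP[h1 h2] := fpart_itv (y + t).
by rewrite /rotate lerDl h1 intrD ltrD2l.
Qed.

Lemma rotateD s t y : rotate s (rotate t y) = rotate (t + s) y.
Proof.
rewrite {1}/rotate floor_rotate; congr (_ + _).
rewrite /rotate {2}/fpart.
rewrite (_ : _ + s = y + (t + s) + (Num.floor y - Num.floor (y + t))%:~R) ?fpartDz//.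
by rewrite intrB; ring.
Qed.

Lemma rotate0 y : rotate 0 y = y.
Proof. by rewrite /rotate addr0 /fpart; ring. Qed.

Lemma rotate_unit t y : 0 <= y < 1 -> rotate t y = fpart (y + t).
Proof. by move=> h; rewrite /rotate (floor_def (m := 0)) ?add0r. Qed.

(** With s the fractional part of t, the rotation of [0, 1[ is the translation by s where y + s < 1
    and by s - 1 elsewhere. The images [s, 1[ and [0, s[ cut A into [A1] and [A2]. *)
Lemma unit_measure_rotate t (A : set R) : measurable A ->
  unit_measure (rotate t @^-1` A) = unit_measure A.
Proof.
move=> mA; rewrite /unit_measure /mrestr.
pose s := fpart t; have /andP[s0 s1] := fpart_itv t; rewrite -/s in s0 s1.
have fpartE y : fpart (y + t) = fpart (y + s).
  by rewrite -(fpartDz (y + s) (Num.floor t)); congr fpart; rewrite /s /fpart; ring.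
pose A1 := A `&` `[s, 1[; pose A2 := A `&` `[0, s[.
have mA1 : measurable A1 by exact: measurableI.
have mA2 : measurable A2 by exact: measurableI.
have mshift u (E : set R) : measurable E -> measurable ((fun y : R => y + u) @^-1` E).
  move=> mE; rewrite -[X in measurable X]setTI.
  by apply: (@measurable_funD _ R R setT id (cst u)).
have -> : rotate t @^-1` A `&` `[0, 1[ =
    ((fun y => y + s) @^-1` A1) `|` ((fun y => y + (s - 1)) @^-1` A2).
  apply/seteqP; split => y /=; rewrite !in_itv /=.
    move=> [Ay y01]; move: Ay; rewrite rotate_unit// fpartE => Ay.
    have /andP[y0 y1] := y01.
    have [ys|ys] := ltP (y + s) 1.
      left; move: Ay; rewrite fpart_id; last by apply/andP; split; lra.
      by split => //=; rewrite in_itv/=; apply/andP; split; lra.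
    right; move: Ay; rewrite -(fpartDz _ (-1)) intrN mulr1z -addrA fpart_id; last first.
      by apply/andP; split; lra.
    by split => //=; rewrite in_itv/=; apply/andP; split; lra.
  move=> [] [Ay]; rewrite /= in_itv/= => /andP[y0 y1].
    have y01 : 0 <= y < 1 by apply/andP; split; lra.
    by split => //; rewrite rotate_unit// fpartE fpart_id//; apply/andP; split; lra.
  have y01 : 0 <= y < 1 by apply/andP; split; lra.
  split => //; rewrite rotate_unit// fpartE -(fpartDz _ (-1)) intrN mulr1z -addrA fpart_id//.
  by apply/andP; split; lra.
have -> : A `&` `[0, 1[ = A1 `|` A2.
  rewrite /A1 /A2 -setIUr; congr (_ `&` _); apply/seteqP.
  split => y /=; rewrite !in_itv/=.
    by move=> /andP[y0 y1]; case: (ltP y s) => ys; [right|left]; apply/andP; split; lra.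
  by move=> [] /andP[? ?]; apply/andP; split; lra.
rewrite !measureU//; first by congr (_ + _)%E; exact: lebesgue_measure_shift.
- apply/seteqP; split => // y /= [] [_ +] [_]; rewrite /= !in_itv/=.
  by move=> /andP[? ?] /andP[? ?]; lra.
- exact: mshift.
- exact: mshift.
- apply/seteqP; split => // y /= [] [_ +] [_]; rewrite /= !in_itv/=.
  by move=> /andP[? ?] /andP[? ?]; lra.
Qed.

Lemma measurable_floor : measurable_fun [set: R] (fun y : R => (Num.floor y)%:~R : R).
Proof.
by apply: nondecreasing_measurable => // x y xy; rewrite ler_int le_floor.
Qed.

End unit_measure.

(** * The skew product and the return of the half strip *)

Section skew_product.
Variable R : realType.
Notation X := (measurableTypeR R * measurableTypeR R)%type.

Definition skew (x : R -> R) (z : X) : X := (z.1, rotate R (x z.1) z.2).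

Lemma skewK (x x' : R -> R) : (forall w, x' w = - x w) -> cancel (skew x) (skew x').
Proof.
by move=> xx' [w y]; rewrite /skew /= rotateD xx' subrr rotate0.
Qed.

Lemma measurable_skew (x : R -> R) : measurable_fun [set: R] x ->
  measurable_fun [set: X] (skew x).
Proof.
move=> mx; apply/measurable_fun_pairP; split; first exact: measurable_fst.
have m1 : measurable_fun [set: X] (fun z : X => z.2 : R) by exact: measurable_snd.
have m2 : measurable_fun [set: X] (fun z : X => z.2 + x z.1).
  apply: measurable_funD => //; apply: measurableT_comp => //; exact: measurable_fst.
have mf := measurable_floor R.
apply: (@measurable_funD _ X R setT (fun z : X => (Num.floor z.2)%:~R : R)
  (fun z : X => fpart R (z.2 + x z.1))).
  exact: (measurableT_comp mf m1).
apply: measurable_funB => //.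
exact: (measurableT_comp mf m2).
Qed.

(** The product measure integrates the measures of fibres, and the fibre of the preimage is by
    conversion the preimage of the fibre under a rotation. *)
Lemma skew_invariant (x : R -> R) : measurable_fun [set: R] x ->
  forall A : set X, measurable A -> square_measure R (skew x @^-1` A) = square_measure R A.
Proof.
move=> mx A mA; rewrite /square_measure /product_measure1.
apply: eq_integral => w _ /=.
rewrite -[RHS](unit_measure_rotate R (x w)); last exact: measurable_xsection.
by [].
Qed.

Variable x : R -> R.
Hypothesis mx : measurable_fun [set: R] x.

Let mNx : measurable_fun [set: R] (fun w => - x w).
Proof. exact: measurable_funN. Qed.

Definition skew_pps : invertible_pps R :=
  @InvertiblePPS R _ X (square_measure R) (skew x) (skew (fun w => - x w))
    (skewK x _ (fun=> erefl)) (skewK (fun w => - x w) x (fun w => esym (opprK (x w))))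
    (measurable_skew x mx) (measurable_skew _ mNx) (skew_invariant x mx).

Lemma iter_skew (y : R -> R) n (z : X) :
  iter n (skew y) z = (z.1, rotate R (n%:R * y z.1) z.2).
Proof.
elim: n => [|n IH]; first by rewrite mul0r rotate0; case: z.
by rewrite iterS IH /skew /= rotateD -addn1 natrD mulrDl mul1r.
Qed.

Lemma pps_iter_skew (k : int) (z : X) :
  pps_iter skew_pps k z = (z.1, rotate R (k%:~R * x z.1) z.2).
Proof.
case: k => n; rewrite /pps_iter iter_skew //.
by rewrite mulrN -mulNr NegzE intrN.
Qed.

Definition half_strip : set X := setT `*` `[0, 1 / 2[.

Lemma measurable_half_strip : measurable half_strip.
Proof. by apply: measurableX => //; exact: measurable_itv. Qed.

Lemma unit_measure_itv (a b : R) : 0 <= a <= b -> b <= 1 ->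
  unit_measure R `[a, b[ = (b - a)%:E.
Proof.
move=> /andP[a0 ab] b1; rewrite /unit_measure /mrestr setIidl.
  by rewrite lebesgue_measure_itv/= lte_fin; case: ltP => // ba; congr EFin; lra.
by move=> y /=; rewrite !in_itv/= => /andP[? ?]; apply/andP; split; lra.
Qed.

Lemma square_measureX (A B : set R) : measurable A -> measurable B ->
  square_measure R (A `*` B) = (unit_measure R A * unit_measure R B)%E.
Proof. by move=> mA mB; rewrite /square_measure product_measure1E. Qed.

Lemma square_measure_strip (a b : R) : 0 <= a <= b -> b <= 1 ->
  square_measure R (setT `*` `[a, b[) = (b - a)%:E.
Proof.
move=> ab b1; rewrite square_measureX// [X in (X * _)%E]probability_setT mul1e.
exact: unit_measure_itv.
Qed.

Lemma half_stripE : square_measure R half_strip = (1 / 2)%:E.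
Proof. by rewrite square_measure_strip ?subr0//; [apply/andP; split|]; lra. Qed.

Lemma measurable_pps_iter (k : int) :
  measurable_fun [set: X] (pps_iter skew_pps k : X -> X).
Proof.
have -> : (pps_iter skew_pps k : X -> X) = skew (fun w => k%:~R * x w).
  by apply/funext => z; rewrite pps_iter_skew.
by apply: measurable_skew; exact: measurable_funM.
Qed.

(** Outside G the rotation is a half turn up to e, and throws [0, 1/2[ into [1/2, 1[ except near the
    ends. The strip over G and two strips of height e thus cover the return set. *)
Lemma half_strip_return (k : int) (G : set R) (e : R) : measurable G -> 0 <= e -> e <= 1 / 4 ->
  (forall w, ~ G w -> approx_mod1 R (k%:~R * x w) (1 / 2) e) ->
  (square_measure R (half_strip `&` (pps_iter skew_pps k @^-1` half_strip)) <=
    unit_measure R G * (1 / 2)%:E + (e *+ 2)%:E)%E.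
Proof.
move=> mG e0 e4 Gx.
pose E1 : set X := G `*` `[0, 1 / 2[.
pose E2 : set X := setT `*` `[0, e[.
pose E3 : set X := setT `*` `[1 / 2 - e, 1 / 2[.
have mE1 : measurable E1 by apply: measurableX => //; exact: measurable_itv.
have mE2 : measurable E2 by apply: measurableX => //; exact: measurable_itv.
have mE3 : measurable E3 by apply: measurableX => //; exact: measurable_itv.
have -> : (unit_measure R G * (1 / 2)%:E + (e *+ 2)%:E =
    square_measure R E1 + square_measure R E2 + square_measure R E3)%E.
  rewrite square_measureX// unit_measure_itv ?lexx//=; [|lra..].
  rewrite !square_measure_strip; [|by apply/andP; split; lra|lra|by apply/andP; split; lra|lra].
  by rewrite subr0 -addeA; congr (_ + _)%E; rewrite -EFinD; congr EFin; lra.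
apply: (@le_trans _ _ (square_measure R (E1 `|` E2 `|` E3))).
  apply: le_measure; rewrite ?inE.
  - apply: measurableI; first exact: measurable_half_strip.
    rewrite -[X in measurable X]setTI.
    exact: (measurable_pps_iter k measurableT _ measurable_half_strip).
  - by apply: measurableU => //; apply: measurableU.
  - move=> [w y] [[_ /=]]; rewrite in_itv/= => /andP[y0 y1] [_ /=].
    rewrite pps_iter_skew /= in_itv /= rotate_unit => [/andP[_ h]|]; last by apply/andP; split; lra.
    have [Gw|nGw] := pselect (G w); first by left; left; split=> //=; rewrite in_itv/=; apply/andP.
    have [z /ler_normlP[h1 h2]] := Gx _ nGw.
    pose v := k%:~R * x w - 1 / 2 - z%:~R.
    have vE : k%:~R * x w = v + 1 / 2 + z%:~R by rewrite /v; ring.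
    have [h1' h2'] : - e <= v /\ v <= e by rewrite /v; split; lra.
    move: h; rewrite vE addrA fpartDz => h.
    have [ye|ye] := ltP y e; first by left; right; split => //=; rewrite in_itv/=; apply/andP.
    have [ye'|ye'] := leP (1 / 2 - e) y; first by right; split => //=; rewrite in_itv/=; apply/andP.
    (* Now y lies in [e, 1/2 - e[, so y + v + 1/2 lies in [1/2, 1[ and equals its fractional part,
       against [h]. *)
    by move: h; rewrite fpart_id; [|apply/andP; split]; lra.
apply: (le_trans (measureU2 _ _ _)) => //; first exact: measurableU.
by apply: leeD => //; exact: measureU2.
Qed.

End skew_product.

(** * A uniform index from a uniform real number *)

Lemma measurable_truncn_preimage (R : realType) (K : nat) (S : set nat) :
  measurable [set w : R | S (Num.truncn (K%:R * w))].
Proof.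
have mf : measurable_fun [set: R] (fun w : R => (Num.truncn (K%:R * w))%:R : R).
  apply: nondecreasing_measurable => // u v uv; rewrite ler_nat le_truncn//.
  by rewrite ler_wpM2l.
rewrite (_ : [set _ | _] = \bigcup_(j in S)
    (fun w : R => (Num.truncn (K%:R * w))%:R : R) @^-1` [set j%:R]).
  apply: bigcup_measurable => j _.
  by rewrite -[X in measurable X]setTI; exact: mf.
apply/seteqP; split => w /=; first by move=> Sw; exists (Num.truncn (K%:R * w)).
by move=> [j Sj /= /eqP]; rewrite eqr_nat => /eqP ->.
Qed.

(** On [0, 1[ the truncation is j exactly on a cell of length 1/K; Boole's inequality sums over the
    cells selected by S. *)
Lemma unit_measure_truncn_preimage (R : realType) (K : nat) (S : pred nat) : (0 < K)%N ->
  (unit_measure R [set w : R | S (Num.truncn (K%:R * w))] <=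
    ((\sum_(j < K) S j)%N%:R / K%:R)%:E)%E.
Proof.
move=> K0; have K0' : 0 < K%:R :> R by rewrite ltr0n.
pose F j : set R := if S j then `[j%:R / K%:R, j.+1%:R / K%:R[%classic else set0.
have mF j : measurable (F j) by rewrite /F; case: ifP => // _; exact: measurable_itv.
have muF j : (lebesgue_measure (F j) <= ((S j)%:R / K%:R)%:E)%E.
  rewrite /F; case: ifP => _; last by rewrite measure0 mul0r.
  rewrite lebesgue_measure_itv/= lte_fin ltr_pM2r ?invr_gt0// ltr_nat leqnn -EFinB lee_fin.
  by rewrite -mulrBl -natrB// subSnn.
have mS := measurable_truncn_preimage R K S.
rewrite /unit_measure /mrestr.
apply: (@le_trans _ _ (lebesgue_measure (\big[setU/set0]_(j < K) F j))).
  apply: le_measure; rewrite ?inE.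
  - by apply: measurableI => //; exact: measurable_itv.
  - by apply: bigsetU_measurable => j _; exact: mF.
  - move=> w [/= Sw]; rewrite in_itv/= => /andP[w0 w1].
    have Kw0 : 0 <= K%:R * w by rewrite mulr_ge0.
    have /andP[h1 h2] := truncn_itv Kw0.
    have jK : (Num.truncn (K%:R * w) < K)%N.
      by rewrite -(ltr_nat R) (le_lt_trans h1)// gtr_pMr.
    rewrite -bigcup_mkord; exists (Num.truncn (K%:R * w)) => //.
    by rewrite /F Sw /= in_itv/= ler_pdivrMr// ltr_pdivlMr// [w * _]mulrC h1 h2.
apply: (le_trans (Boole_inequality _ _)) => [j _|]; first exact: mF.
rewrite natr_sum mulr_suml -sumEFin; apply: lee_sum => j _.
exact: muF.
Qed.

(** The parities are independent: these pairs form the square of a set of density 1/2. *)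
Lemma card_even_pair (r : nat) (F : {set 'I_r}) (F0 : F != finset.set0) :
  (#|[pred c : {set 'I_r} * {set 'I_r} | ~~ (odd #|c.1 :&: F| || odd #|c.2 :&: F|)%SET]| * 4
   = #|{: {set 'I_r} * {set 'I_r}}|)%N.
Proof.
have h := @card_even_setI r F F0; set E := finset _ in h.
rewrite (eq_card (B := finset.setX E E)).
  rewrite cardsX card_prod -cardsT -powersetT card_powerset cardsT card_ord -h.
  ring.
by move=> [U V]; rewrite !inE /= negb_or.
Qed.

(** * Superposing the ranks *)

Lemma dvdz_horner (p : {poly int}) (m : int) : p.[0] = 0 -> (m %| p.[m])%Z.
Proof.
move=> p0; have /factor_theorem[q ->] : root p 0 by apply/rootP.
by rewrite hornerM hornerXsubC subr0 dvdz_mull.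
Qed.

Lemma ip_frequency_tower (R : realType) (p : {poly int}) (p0 : p.[0] = 0)
    (degp : (1 < (size p).-1)%N) (e : R) : 0 < e -> e <= 1 ->
  exists (n : forall r, 'I_r -> nat) (Y : forall r, {set 'I_r} * {set 'I_r} -> R),
  forall r, [/\ (forall i, 0 < n r i)%N,
      (forall i j : 'I_r, i < j -> n r i < n r j)%N,
      forall c, `|Y r c| <= 2^-1 ^+ r,
      forall (F : {set 'I_r}) c, odd #|c.1 :&: F| || odd #|c.2 :&: F| ->
        approx_mod1 R ((p.[(\sum_(i in F) n r i)%N%:Z])%:~R * Y r c) (1 / 2) e &
      forall (F : {set 'I_r}) s c,
        ((s < r)%N -> (p.[(\sum_(i in F) n r i)%N%:Z])%:~R * Y s c \is a Num.int) /\
        ((r < s)%N -> `|(p.[(\sum_(i in F) n r i)%N%:Z])%:~R * Y s c| <= e * 2^-1 ^+ (s - r))].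
Proof.
move=> e0 e1.
pose level r := (('I_r -> nat) * nat * ({set 'I_r} * {set 'I_r} -> R))%type.
pose spec r D (h : R) (L : level r) := (0 < D)%N -> 0 < h ->
  [/\ (forall i, 0 < L.1.1 i /\ D %| L.1.1 i)%N,
      (forall i j : 'I_r, i < j -> L.1.1 i < L.1.1 j)%N,
      (0 < L.1.2)%N,
      forall c, `|L.2 c| <= h /\ L.1.2%:R * L.2 c \is a Num.int &
      forall (F : {set 'I_r}) c, odd #|c.1 :&: F| || odd #|c.2 :&: F| ->
        approx_mod1 R ((p.[(\sum_(i in F) L.1.1 i)%N%:Z])%:~R * L.2 c) (1 / 2) h].
(* [spec] is vacuous unless D and h are positive, so dummy data allow a choice before positivity is
   known along the recursion. *)
have ex r D h : {L | spec r D h L}.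
  apply: cid; have [[D0 h0]|nDh] := pselect ((0 < D)%N /\ 0 < h).
    have [n [M [Y H]]] := @ip_frequencies R p p0 degp r D h D0 h0.
    by exists (n, M, Y) => _ _.
  by exists (fun=> 0%N, 0%N, fun=> 0) => D0 h0; case: nDh.
pose L r (s : nat * R) : level r := sval (ex r s.1 s.2).
pose size_at r (l : level r) : R :=
  \sum_(F : {set 'I_r}) `|p.[(\sum_(i in F) l.1.1 i)%N%:Z]|%:~R.
(* The state is the product D of the denominators so far and the bound h for the next frequencies.
   Halving h gives geometric decay; the other bound makes later frequencies small against p at every
   subset sum of rank r, as [size_at] dominates all these values. *)
pose next r (s : nat * R) : nat * R := ((s.1 * (L r s).1.2)%N,
  Num.min (s.2 / 2) (e / 2 / (1 + size_at r (L r s)))).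
pose st := fix st r := if r is k.+1 then next k (st k) else (1%N, e).
have size0 r l : 0 <= size_at r l by apply: sumr_ge0 => F _; rewrite ler0z.
have LP r : spec r (st r).1 (st r).2 (L r (st r)) by exact: (svalP (ex r _ _)).
have st0 r : (0 < (st r).1)%N /\ 0 < (st r).2.
  elim: r => [|r [D0 h0]] //; have [_ _ M0 _ _] := LP r D0 h0.
  split; first by rewrite /= muln_gt0 D0.
  by rewrite /= lt_min !divr_gt0// ltr_pwDl.
have {}LP r := LP r (st0 r).1 (st0 r).2.
have stS r : (st r.+1).2 <= (st r).2 / 2 by rewrite /= ge_min lexx.
have st_half r k : (st (k + r)%N).2 <= (st r).2 * 2^-1 ^+ k.
  elim: k => [|k IH]; first by rewrite mulr1.
  rewrite addSn (le_trans (stS _))// exprSr mulrA ler_wpM2r// invr_ge0//.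
have st_dvd s r : (s < r)%N -> ((L s (st s)).1.2 %| (st r).1)%N.
  elim: r => // r IH; rewrite ltnS leq_eqVlt => /orP[/eqP ->|/IH sr].
    by rewrite /= dvdn_mull.
  by rewrite /= dvdn_mulr.
exists (fun r => (L r (st r)).1.1), (fun r => (L r (st r)).2) => r.
have [nP ninc M0 YP approxP] := LP r.
have hle : (st r).2 <= e * 2^-1 ^+ r by have := st_half 0%N r; rewrite addn0.
have h1 : 2^-1 ^+ r <= 1 :> R by rewrite exprn_ile1// invf_le1// ler1n.
split=> //.
- by move=> i; have [] := nP i.
- move=> c; have [Yh _] := YP c.
  by rewrite (le_trans Yh)// (le_trans hle)// ler_piMl// exprn_ge0// invr_ge0.
- move=> F c codd; apply: approx_mod1W (approxP F c codd).
  by rewrite (le_trans hle)// ler_piMr// ltW.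
move=> F s c; have [_ _ _ /(_ c)[Yh Yint] _] := LP s.
set m := p.[_]; split=> [sr|rs].
  (* The denominator of rank s divides all generators of rank r, hence their sums, hence the values
     of p there. *)
  have : (((L s (st s)).1.2)%:Z %| m)%Z.
    apply: dvdz_trans (dvdz_horner p _ p0); rewrite /dvdz !absz_nat.
    apply: dvdn_sum => i _; have [_] := nP i; apply: dvdn_trans.
    exact: st_dvd.
  by move=> /dvdzP[q ->]; rewrite intrM -mulrA rpredM ?intr_int.
(* The bound at rank r + 1 contains e / 2, and this half makes up for the exponent s - r - 1 in
   place of s - r. *)
have hs : (st s).2 <= (st r.+1).2 * 2^-1 ^+ (s - r.+1).
  by have := st_half r.+1 (s - r.+1)%N; rewrite subnK.
have hr : (st r.+1).2 <= e / 2 / (1 + size_at r (L r (st r))).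
  by rewrite /= ge_min lexx orbT.
have msize : `|m|%:~R <= 1 + size_at r (L r (st r)).
  by rewrite /size_at (bigD1 F)//= addrCA lerDl addr_ge0// sumr_ge0//.
have s1 : 0 < 1 + size_at r (L r (st r)) by rewrite ltr_pwDl.
rewrite normrM -intr_norm.
apply: (@le_trans _ _ ((1 + size_at r (L r (st r))) * (st s).2)).
  by rewrite ler_pM// ler0z.
have -> : (s - r)%N = (s - r.+1).+1 by lia.
apply: (@le_trans _ _ ((1 + size_at r (L r (st r))) *
   (e / 2 / (1 + size_at r (L r (st r))) * 2^-1 ^+ (s - r.+1)))).
  rewrite ler_wpM2l// ?(ltW s1)// (le_trans hs)// ler_wpM2r// exprn_ge0// invr_ge0//.
rewrite exprS le_eqVlt; apply/orP; left; apply/eqP.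
by field; rewrite gt_eqF.
Qed.

(** Modulo 1 the terms before r vanish, the r-th is b up to e, and the later ones add at most e (1/2
    + 1/4 + ...) = e. *)
Lemma approx_mod1_series (R : realType) (u : R^nat) (l b e : R) (m : int) (r : nat) :
  0 <= e -> series u @ \oo --> l ->
  (forall s, (s < r)%N -> m%:~R * u s \is a Num.int) ->
  approx_mod1 R (m%:~R * u r) b e ->
  (forall s, (r < s)%N -> `|m%:~R * u s| <= e * 2^-1 ^+ (s - r)) ->
  approx_mod1 R (m%:~R * l) b (e *+ 2).
Proof.
move=> e0 ul before [z1 at_r] after.
have /intrP[z0 hz0] : m%:~R * series u r \is a Num.int.
  by rewrite /series/= mulr_sumr big_mkord rpred_sum// => s _; apply: before.
exists (z0 + z1); set z := z0 + z1.
(* Subtracting the unspent tail makes the induction work; [z] does not depend on k, so the bound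
   passes to the limit. *)
have partial k : `|m%:~R * series u (k + r.+1)%N - b - z%:~R| <= e *+ 2 - e * 2^-1 ^+ k.
  elim: k => [|k IH].
    rewrite mulr1 mulr2n addrK add0n /series/= big_nat_recr//= mulrDr.
    rewrite -[\sum_(_ <= _ < _) _]/(series u r) hz0 /z intrD.
    by rewrite (_ : _ - _ = m%:~R * u r - b - z1%:~R)//; ring.
  rewrite addSn /series/= big_nat_recr//= mulrDr -[\sum_(_ <= _ < _) _]/(series u (k + r.+1)).
  rewrite (_ : _ - _ =
    (m%:~R * series u (k + r.+1)%N - b - z%:~R) + m%:~R * u (k + r.+1)%N); last ring.
  rewrite (le_trans (ler_normD _ _))//.
  have rk : (r < k + r.+1)%N by lia.
  have := after _ rk; rewrite (_ : _ - r = k.+1)%N; last by lia.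
  move=> h; rewrite (le_trans (lerD IH h))// exprS.
  by rewrite le_eqVlt; apply/orP; left; apply/eqP; field.
have cv : `|m%:~R * series u n - b - z%:~R| @[n --> \oo] --> `|m%:~R * l - b - z%:~R|.
  apply: cvg_norm; apply: cvgB; last exact: cvg_cst.
  by apply: cvgB; [exact: cvgMr|exact: cvg_cst].
apply: (cvgr_to_le cv); exists r.+1 => // n /= rn.
have := partial (n - r.+1)%N; rewrite subnK// => /le_trans; apply.
by rewrite lerBlDr lerDl mulr_ge0// exprn_ge0// invr_ge0.
Qed.

Lemma measurable_random_frequency (R : realType) (K : nat) (Y : nat -> R) :
  measurable_fun [set: R] (fun w : R => Y (Num.truncn (K%:R * w))).
Proof.
move=> _ B mB; rewrite setTI.
exact: (measurable_truncn_preimage R K [set j | B (Y j)]).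
Qed.

Lemma cvg_series_half (R : realType) (u : R^nat) :
  (forall n, `|u n| <= 2^-1 ^+ n) -> cvgn (series u).
Proof.
move=> uh; apply: normed_cvg.
apply: (series_le_cvg _ _ _ (@is_cvg_geometric_series R 1 2^-1 _)) => //=.
- by move=> n; rewrite /= mul1r.
- by rewrite ger0_norm ?invr_ge0// invf_lt1// ltr1n.
Qed.

Lemma sum_nth_enum (T : finType) (x0 : T) (P : pred T) :
  (\sum_(j < #|T|) P (nth x0 (enum T) j) = #|P|)%N.
Proof.
have -> : #|P| = (\sum_(x <- enum T | P x) 1)%N.
  by rewrite big_enum_cond -sum1_card; apply: eq_bigl => x; rewrite inE.
rewrite (big_nth x0) -cardE big_mkord [RHS]big_mkcond.
by apply: eq_bigr => j _; case: (P _).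
Qed.

Theorem theoremA (R : realType) (p : {poly int}) (p0 : p.[0] = 0)
    (degp : (1 < (size p).-1)%N) :
  exists (S : invertible_pps R) (A : set (pps_space S)) (delta : R)
         (Gamma : set nat),
    [/\ measurable A,
        pps_mu S A = (1 / 2)%:E,
        0 < delta,
        Gamma `<=` [set n | (0 < n)%N] /\ is_IP_0 Gamma
      & forall n : nat, Gamma n ->
          (pps_mu S (A `&` (pps_iter S p.[n%:Z] @^-1` A))
             < pps_mu S A ^+ 2 - delta%:E)%E].
Proof.
(* With e = 1/64, x is accurate to 2e = 1/32, and the return has measure at most 1/4 * 1/2 + 2/32 =
   3/16, below 1/4 - 1/32 = 7/32. *)
have [e0 e1] : 0 < 1 / 64 :> R /\ 1 / 64 <= 1 :> R by split; lra.
have [n [Y nY]] := @ip_frequency_tower R p p0 degp _ e0 e1.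
pose C r := ({set 'I_r} * {set 'I_r})%type.
pose K r := #|{: C r}|.
(* One w drives all ranks: only the law within rank r matters, the other ranks being controlled for
   every outcome. The default pair is reached only for w >= 1, outside the support of the
   measure. *)
pose pair r j : C r := nth (finset.set0, finset.set0) (enum {: C r}) j.
pose y r (w : R) : R := Y r (pair r (Num.truncn ((K r)%:R * w))).
pose x (w : R) := limn (series (y ^~ w)).
have ycvg w : series (y ^~ w) @ \oo --> x w.
  by apply: cvg_series_half => r; have [_ _ + _ _] := nY r; apply.
have my r : measurable_fun setT (y r).
  exact: (measurable_random_frequency R (K r) (Y r \o pair r)).
have mx : measurable_fun setT x.
  apply: (@measurable_fun_cvg _ _ R setT (fun N w => series (y ^~ w) N : R)) => [N|w _].
    by rewrite /series /=; apply: measurable_sum => r; exact: my.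
  exact: ycvg.
pose Gamma : set nat := [set m | exists r (F : {set 'I_r}),
  F != finset.set0 /\ m = (\sum_(i in F) n r i)%N].
exists (skew_pps R x mx), (half_strip R), (1 / 32), Gamma.
have muA := half_stripE R.
split.
- exact: measurable_half_strip.
- exact: muA.
- lra.
- split=> [m [r [F [/set0Pn[i iF] ->]]] /=|r r0].
    by rewrite (bigD1 i)//= addn_gt0; have [+ _ _ _ _] := nY r => ->.
  exists (n r); have [npos ninc _ _ _] := nY r; split => // F F0.
  by exists r, F.
move=> _ [r [F [F0 ->]]].
set m := p.[_].
(* Both intersections are even, which holds for a quarter of the pairs. *)
pose bad (j : nat) := ~~ (odd #|(pair r j).1 :&: F| || odd #|(pair r j).2 :&: F|)%SET.
pose G : set R := [set w | bad (Num.truncn ((K r)%:R * w))].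
have mG : measurable G := measurable_truncn_preimage R (K r) bad.
have [_ _ _ Yr Ys] := nY r.
have Kbad : ((\sum_(j < K r) bad j) * 4 = K r)%N.
  by rewrite -[RHS](card_even_pair r F F0) -(sum_nth_enum _ (finset.set0, finset.set0)).
have muG : (unit_measure R G <= (1 / 4)%:E)%E.
  have K0 : (0 < K r)%N by rewrite /K; apply/card_gt0P; exists (finset.set0, finset.set0).
  apply: (le_trans (unit_measure_truncn_preimage R (K r) bad K0)).
  rewrite lee_fin ler_pdivrMr ?ltr0n// -[in leRHS]Kbad natrM; lra.
have Gx w : ~ G w -> approx_mod1 R (m%:~R * x w) (1 / 2) (1 / 64 *+ 2).
  move=> /negP; rewrite negbK => codd.
  apply: (@approx_mod1_series R (y ^~ w) _ _ _ m r) => //.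
  - by move=> s sr; have [+ _] := Ys F s (pair s (Num.truncn ((K s)%:R * w))); apply.
  - exact: Yr.
  - by move=> s rs; have [_] := Ys F s (pair s (Num.truncn ((K s)%:R * w))); apply.
have bound := @half_strip_return R x mx m G _ mG _ _ Gx.
apply: (le_lt_trans (bound _ _)); [lra|lra|].
rewrite [X in (_ < X ^+ 2 - _)%E]muA.
apply: (@le_lt_trans _ _ ((1 / 4)%:E * (1 / 2)%:E + (1 / 64 *+ 2 *+ 2)%:E)%E).
  by rewrite leeD2r// lee_wpmul2r// lee_fin.
rewrite -EFinM -EFinD expe2 -EFinM -EFinB lte_fin; lra.
Qed.
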